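(* For every $\epsilon>0$, with probability tending to $1$ as $n\to\infty$, $$\max_{t\in\{1,\ldots,n\}}D^{(t)}\le(1+\epsilon)\frac{\log n}{\log\log n}.$$
   Context: $\mathbb{N}=\{1,2,\ldots\}$. Let $Z_1,Z_2,\ldots$ be independent, identically distributed random variables taking values in $\mathbb{N}$ (with arbitrary distribution). In the subtractive random forest on vertex set $\mathbb{Z}$, integers $i\le 0$ are roots and each $n\in\mathbb{N}$ is attached to its parent $n-Z_n$. The (out)degree of an integer $i$ in the final forest is $D^{(i)}=\sum_{t=\max(1,i+1)}^\infty\mathbf{1}_{\{Z_t=t-i\}}$, the number of $t\in\mathbb{N}$ whose parent is $i$. *)

(* Defs.v *)
(* MathComp-Analysis *)
From mathcomp Require Export all_boot all_order all_algebra finmap.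
From mathcomp Require Export all_classical all_reals all_analysis.

Set Implicit Arguments.
Unset Strict Implicit.
Unset Printing Implicit Defensive.

Export Order.TTheory GRing.Theory Num.Theory.
Export numFieldNormedType.Exports.

Local Open Scope classical_set_scope.
Local Open Scope ring_scope.

(* Mutual independence of the random variables X i, i in I0: product rule on
   every finite subfamily. *)
Definition independent_RVs d d' (T : measurableType d) (T' : measurableType d')
    (R : realType) (P : probability T R) (I : choiceType) (I0 : set I)
    (X : I -> {RV P >-> T'}) : Prop :=
  forall (J : {fset I}) (A : I -> set T'),
    [set` J] `<=` I0 ->
    (forall i, i \in J -> measurable (A i)) ->
    P (\bigcap_(i in [set` J]) (X i @^-1` A i)) =
    (\prod_(i <- J) P (X i @^-1` A i))%E.

Definition identically_distributed d d' (T : measurableType d)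
    (T' : measurableType d') (R : realType) (P : probability T R)
    (I : Type) (I0 : set I) (X : I -> {RV P >-> T'}) : Prop :=
  forall i j, I0 i -> I0 j -> forall A, measurable A ->
    distribution P (X i) A = distribution P (X j) A.

(* Outdegree of the vertex i in the subtractive forest in which every integer
   t >= 1 has parent t - z t; the value z 0 is never used. The number of
   children of i may be infinite, hence the values in \bar R. *)
Definition degree (R : realType) (z : nat -> nat) (i : int) : \bar R :=
  (\sum_(0 <= t <oo | (Num.max 1 (i + 1) <= t%:Z)%R)
     ((z t)%:Z == t%:Z - i)%R%:R%:E)%E.

(* Main.v *)
Require Import Defs.
From mathcomp Require Import ring lra zify.

Set Implicit Arguments.
Unset Strict Implicit.
Unset Printing Implicit Defensive.

(** The degree of a vertex i >= 1 counts which of the events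
    A_s = {Z_s = s - i}, s > i, occur. These events are independent, and as the
    Z_s share one law q, their probabilities q(1), q(2), ... add up to at
    most 1. Hence the exponential moments of the degree are at most those of a
    Poisson variable of mean 1, so that its tail is about 1 / k! at most, and
    n / k! becomes small once k exceeds log n / log log n by a factor 1 + eps.

    The tail bound needs no integration. More than x of the events
    A_0, ..., A_(m-1) occur iff all of A_s, s in J, occur for some J of
    cardinal > x. A union bound over J, independence, and the factor
    c^(#|J| - x) >= 1 for any c >= 1 give at most
      c^(-x) * sum_J prod_(s in J) c P(A_s) = c^(-x) * prod_s (1 + c P(A_s))
                                           <= exp(c * sum_s P(A_s) - x ln c),
    the sum now running over all J (prob_occurrences_gt). This is uniform in m,
    so it passes to the increasing limit (prob_bigcup_occurrences_gt) and gives
    P(D^(i) > x) <= exp(c - x ln c) (prob_degree_gt). A union bound over the n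
    vertices then leaves n exp(c - x ln c) (prob_max_degree_le).

    With L = ln n, x = (1 + eps) L / ln L and c = delta L, the exponent is
      L + delta L - (1 + eps) L - (1 + eps) (ln delta) L / ln L,
    and with delta = eps / 4 it is eventually at most - (eps / 2) L, so the
    bound tends to 0 (union_bound_cvg0). *)

Local Open Scope classical_set_scope.
Local Open Scope ring_scope.

(** * Counting occurrences of events *)

Definition independent_events d (T : measurableType d) (R : realType)
    (P : probability T R) (A : nat -> set T) : Prop :=
  forall J : {fset nat},
    P (\bigcap_(s in [set` J]) A s) = (\prod_(s <- J) P (A s))%E.

Definition occurrences (T : Type) (A : nat -> set T) (m : nat) (w : T) : nat :=
  (\sum_(s < m) (w \in A s))%N.

Lemma occurrences_homo (T : Type) (A : nat -> set T) (w : T) :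
  {homo (fun m => occurrences A m w) : m n / (m <= n)%N}.
Proof.
apply: homo_leq => // [|m]; first exact: leq_trans.
by rewrite /occurrences big_ord_recr leq_addr.
Qed.

(** Turning the count into a finite union of intersections makes the event
    measurable and lets the product rule of independence apply directly. *)
Lemma occurrences_gtE (R : realType) (T : Type) (A : nat -> set T) (m : nat)
    (x : R) :
  [set w | x < (occurrences A m w)%:R] =
  \bigcup_(J in [set J : {set 'I_m} | x < #|J|%:R])
    \bigcap_(s in [set` J]) A s.
Proof.
apply/seteqP; split=> [w /= xw | w [J /= xJ JA]].
  exists [set s : 'I_m | w \in A s]%SET => /=.
    by rewrite -sum1dep_card big_mkcond.
  by move=> s /=; rewrite inE => /set_mem.
apply: (lt_le_trans xJ); rewrite ler_nat /occurrences -sum1_card big_mkcond.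
apply: leq_sum => s _; case: ifP => // sJ.
by rewrite (mem_set (JA s sJ)).
Qed.

Lemma measurable_occurrences_gt (R : realType) d (T : measurableType d)
    (A : nat -> set T) (m : nat) (x : R) :
  (forall s, measurable (A s)) ->
  measurable [set w | x < (occurrences A m w)%:R].
Proof.
move=> mA; rewrite occurrences_gtE.
apply: fin_bigcup_measurable => [|J _]; first exact: finite_finset.
by apply: fin_bigcap_measurable => //; exact: finite_finset.
Qed.

Lemma prob_bigcap_ord d (T : measurableType d) (R : realType)
    (P : probability T R) (A : nat -> set T) (m : nat) (J : {set 'I_m}) :
  independent_events P A ->
  P (\bigcap_(s in [set` J]) A s) = (\prod_(s in J) P (A s))%E.
Proof.
move=> indA.
have -> : \bigcap_(s in [set` J]) A s =
    \bigcap_(s in [set` [fset val i | i in J]%fset]) A s.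
  apply/seteqP; split=> w Aw s /=.
    by move=> /imfsetP[i /= iJ ->]; exact: Aw.
  move=> sJ; apply: Aw => /=.
  by apply/imfsetP; exists s.
rewrite indA big_imfset /=; last by move=> i j _ _; exact: val_inj.
by rewrite big_enum.
Qed.

(** * A Chernoff bound for independent events *)

(** The weight c^(#|J| - x) inserted in the union bound plays the part of the
    exponential moment: summed over all J, it factorizes over s. *)
Lemma prob_occurrences_gt (R : realType) d (T : measurableType d)
    (P : probability T R) (A : nat -> set T) (m : nat) (mu c x : R) :
  (forall s, measurable (A s)) -> independent_events P A ->
  (\sum_(s < m) P (A s) <= mu%:E)%E -> 1 <= c ->
  (P [set w | (x < (occurrences A m w)%:R)%R]
     <= (expR (c * mu - x * ln c))%:E)%E.
Proof.
move=> mA indA sumA c1.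
have c0 : 0 < c by lra.
pose p (s : nat) := fine (P (A s)).
have pE s : P (A s) = (p s)%:E by rewrite fineK// fin_num_measure.
have p0 s : 0 <= p s by rewrite fine_ge0.
have prodE (J : {set 'I_m}) :
    P (\bigcap_(s in [set` J]) A s) = (\prod_(s in J) p s)%:E.
  rewrite prob_bigcap_ord// -prodEFin.
  by apply: eq_bigr => s _; rewrite pE.
pose D := [set J : {set 'I_m} | x < #|J|%:R].
have subD : [set w | x < (occurrences A m w)%:R] `<=`
    \bigcup_(J in D) \bigcap_(s in [set` J]) A s.
  by rewrite -occurrences_gtE.
have mJ (J : {set 'I_m}) : measurable (\bigcap_(s in [set` J]) A s).
  by apply: fin_bigcap_measurable => //; exact: finite_finset.
apply: (le_trans (content_sub_fsum P (finite_finset (X := D))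
  (fun J _ => mJ J) (measurable_occurrences_gt _ _ mA) subD)).
have -> : D = [set` enum [pred J : {set 'I_m} | x < #|J|%:R]].
  by apply/seteqP; split=> J /=; rewrite mem_enum.
rewrite -fsbig_seq ?enum_uniq// big_enum /=.
rewrite (eq_bigr _ (fun J _ => prodE J)) sumEFin lee_fin.
apply: (@le_trans _ _ (expR (- (x * ln c)) *
    \sum_(J : {set 'I_m}) \prod_(s in J) (c * p s))).
  rewrite mulr_sumr.
  apply: (@le_trans _ _ (\sum_(J | J \in [pred J : {set 'I_m} | x < #|J|%:R])
      expR (- (x * ln c)) * \prod_(s in J) (c * p s))).
    apply: ler_sum => J; rewrite inE => xJ.
    rewrite big_split /= prodr_const mulrA ler_peMl//.
      by apply: prodr_ge0.
    (* The inserted weight c^(#|J| - x) is at least 1, as #|J| > x and c >= 1. *)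
    rewrite -[X in X ^+ _](@lnK _ c)// -expRM_natl -expRD.
    rewrite -[leLHS]expR0 ler_expR.
    have : 0 <= ln c by exact: ln_ge0.
    nra.
  (* The sets J with #|J| <= x are added back, to reach the full sum. *)
  rewrite [leRHS](bigID (mem [pred J : {set 'I_m} | x < #|J|%:R])) /= lerDl.
  apply: sumr_ge0 => J _; rewrite mulr_ge0 ?expR_ge0// prodr_ge0// => s _.
  by rewrite mulr_ge0// ltW.
(* Expanding the product chooses, for each s, whether s belongs to J. *)
have -> : \sum_(J : {set 'I_m}) \prod_(s in J) (c * p s) =
    \prod_(s < m) (1 + c * p s).
  under [RHS]eq_bigr do rewrite addrC.
  by rewrite bigA_distr; apply: eq_bigr => J _; rewrite big_mkcond.
rewrite addrC expRD ler_wpM2l ?expR_ge0//.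
apply: (@le_trans _ _ (expR (\sum_(s < m) c * p s))).
  rewrite expR_sum; apply: ler_prod => s _.
  by rewrite expR_ge1Dx addr_ge0// mulr_ge0// ltW.
rewrite ler_expR -mulr_sumr ler_pM2l//.
rewrite -lee_fin -sumEFin; apply: le_trans sumA.
by apply: lee_sum => s _; rewrite pE.
Qed.

(** A series exceeds x as soon as a partial sum does, even when it diverges;
    strictness matters, since a limit may reach x without any partial sum
    doing so. *)
Lemma gt_nneseries_natr (R : realType) (b : nat -> nat) (x : R) :
  (x%:E < \sum_(0 <= s <oo) (b s)%:R%:E)%E <->
  exists m, x < (\sum_(s < m) b s)%N%:R.
Proof.
have sumE m : (\sum_(0 <= s < m) (b s)%:R%:E)%E =
    (\sum_(s < m) b s)%N%:R%:E :> \bar R.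
  by rewrite big_mkord natr_sum -sumEFin.
split=> [xS | [m xm]].
  apply: contrapT => nS; move: xS; apply/negP; rewrite -leNgt.
  apply: lime_le; first by apply: is_cvg_nneseries => s _ _; rewrite lee_fin.
  apply: nearW => m; rewrite sumE lee_fin leNgt; apply/negP => xm.
  by apply: nS; exists m.
apply: (@lt_le_trans _ _ (\sum_(0 <= s < m) (b s)%:R%:E)%E).
  by rewrite sumE lte_fin.
by apply: nneseries_lim_ge => s _ _; rewrite lee_fin.
Qed.

(** Continuity from below: the finite bound does not depend on m. *)
Lemma prob_bigcup_occurrences_gt (R : realType) d (T : measurableType d)
    (P : probability T R) (A : nat -> set T) (mu c x : R) :
  (forall s, measurable (A s)) -> independent_events P A ->
  (forall m, \sum_(s < m) P (A s) <= mu%:E)%E -> 1 <= c ->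
  (P (\bigcup_m [set w | (x < (occurrences A m w)%:R)%R])
     <= (expR (c * mu - x * ln c))%:E)%E.
Proof.
move=> mA indA sumA c1.
pose F m := [set w | (x < (occurrences A m w)%:R)%R].
have mF m : measurable (F m) by exact: measurable_occurrences_gt.
have cvgF : (P \o F) m @[m --> \oo] --> P (\bigcup_m F m).
  apply: nondecreasing_cvg_mu => //; first exact: bigcup_measurable.
  move=> m n mn; apply/subsetPset => w /= xw.
  by apply: (lt_le_trans xw); rewrite ler_nat; exact: occurrences_homo.
rewrite -(cvg_lim _ cvgF)//; apply: lime_le.
  by apply/cvg_ex; exists (P (\bigcup_m F m)).
by apply: nearW => m; exact: prob_occurrences_gt.
Qed.

(** * Degrees in the forest *)

(** Written with i + k = s rather than k = s - i, so that truncated subtraction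
    never enters; the condition 0 < k makes the event empty for s <= i, which
    lets s range over all of nat. *)
Definition attached (T : Type) (Z : nat -> T -> nat) (i s : nat) : set T :=
  Z s @^-1` [set k | (0 < k)%N /\ (i + k)%N = s].

Lemma degree_gtE (R : realType) (T : Type) (Z : nat -> T -> nat) (i : nat)
    (x : R) :
  [set w | (x%:E < degree R (fun s => Z s w) i%:Z)%E] =
  \bigcup_m [set w | x < (occurrences (attached Z i) m w)%:R].
Proof.
have degreeE w : degree R (fun s => Z s w) i%:Z =
    (\sum_(0 <= s <oo) ((w \in attached Z i s) : nat)%:R%:E)%E.
  rewrite /degree eseries_mkcond; apply: eq_eseriesr => s _.
  case: ifPn => [is_lt | is_ge].
    congr (_%:R%:E); congr nat_of_bool; apply/eqP/idP => [h | /set_mem].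
      by apply/mem_set; rewrite /attached /=; lia.
    by rewrite /attached /=; lia.
  rewrite memNset// /attached /= => -[]; move: is_ge; lia.
apply/seteqP; split=> w /=; rewrite degreeE gt_nneseries_natr.
  by move=> -[m xm]; exists m.
by move=> -[m _ xm]; exists m.
Qed.

Section forest.
Context (R : realType) (d : measure_display)
    (T : measurableType d) (P : probability T R)
    (Z : nat -> {RV P >-> nat})
    (Zindep : independent_RVs [set n : nat | (0 < n)%N] Z)
    (Zid : identically_distributed [set n : nat | (0 < n)%N] Z).

Lemma measurable_attached i s : measurable (attached Z i s).
Proof. by rewrite -[attached _ _ _]setTI; exact: measurable_funPT. Qed.

Lemma attached_le i s : (s <= i)%N -> attached Z i s = set0.
Proof. by move=> si; apply/seteqP; split=> w //; rewrite /attached /=; lia. Qed.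

(** The independence of the Z s covers only s >= 1; an index set containing 0
    is harmless because the event of index 0 is empty. *)
Lemma independent_attached i : independent_events P (attached Z i).
Proof.
move=> J; have [J0|/existsNP[s /not_implyP[sJ /negP]]] :=
  pselect (forall s, s \in J -> (0 < s)%N).
  exact: Zindep.
rewrite -eqn0Ngt => /eqP s0; rewrite s0 {s s0} in sJ.
rewrite (big_fsetD1 0%N sJ) /= attached_le// measure0 mul0e.
rewrite -[RHS](measure0 P); congr (P _); apply/seteqP; split=> w // Jw.
by have := Jw 0%N sJ; rewrite attached_le.
Qed.

(** Since the Z s have a common law, the events can be moved to the single
    variable Z 1, where they become disjoint. *)
Lemma sum_prob_attached i m : (\sum_(s < m) P (attached Z i s) <= 1)%E.
Proof.
pose B s := [set k : nat | (0 < k)%N /\ (i + k)%N = s].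
have PB s : P (attached Z i s) = distribution P (Z 1) (B s).
  have [s0|s0] := posnP s; last by rewrite -(Zid s0).
  rewrite s0 attached_le// (_ : B _ = set0) ?measure0//.
  by apply/seteqP; split=> k //; rewrite /B /=; lia.
under eq_bigr do rewrite PB.
rewrite -(measure_bigsetU (distribution P (Z 1)))//.
  exact: probability_le1.
by move=> s t _ _ [k []]; rewrite /B /=; lia.
Qed.

Lemma measurable_degree_gt (x : R) i :
  measurable [set w | (x%:E < degree R (fun s => Z s w) i%:Z)%E].
Proof.
rewrite (degree_gtE (fun s => Z s)); apply: bigcup_measurable => m _.
by apply: measurable_occurrences_gt; exact: measurable_attached.
Qed.

Lemma prob_degree_gt (c x : R) i : 1 <= c ->
  (P [set w | x%:E < degree R (fun s => Z s w) i%:Z]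
     <= (expR (c - x * ln c))%:E)%E.
Proof.
move=> c1; rewrite (degree_gtE (fun s => Z s)) -[X in expR (X - _)]mulr1.
apply: prob_bigcup_occurrences_gt => //.
- exact: measurable_attached.
- exact: independent_attached.
- exact: sum_prob_attached.
Qed.

Let max_degree_le (x : R) n :=
  [set w : T | (\big[maxe/-oo]_(1 <= t < n.+1)
      degree R (fun s => Z s w) t%:Z <= x%:E)%E].

Lemma max_degree_leE (x : R) n :
  max_degree_le x n = ~` \big[setU/set0]_(t < n)
    [set w | (x%:E < degree R (fun s => Z s w) t.+1%:Z)%E].
Proof.
rewrite -(bigcup_mkord n (fun t =>
  [set w | (x%:E < degree R (fun s => Z s w) t.+1%:Z)%E])).
apply/seteqP; split=> w /=.
  move=> maxw [t /= tn]; apply/negP; rewrite -leNgt.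
  apply: le_trans maxw.
  apply: (@le_bigmax_seq _ _ _ _ _ t.+1 xpredT
    (fun t => degree R (fun s => Z s w) t%:Z)) => //.
  by rewrite mem_index_iota; lia.
move=> nexw; rewrite /max_degree_le /= big_seq.
apply: bigmax_le => [|t]; first exact: leNye.
rewrite mem_index_iota => /andP[t0 tn]; rewrite leNgt; apply/negP => xt.
by apply: nexw; exists t.-1; rewrite /= ?prednK//; lia.
Qed.

Lemma measurable_max_degree_le (x : R) n : measurable (max_degree_le x n).
Proof.
rewrite max_degree_leE; apply: measurableC; apply: bigsetU_measurable => t _.
exact: measurable_degree_gt.
Qed.

Lemma prob_max_degree_le (c x : R) n : 1 <= c ->
  ((1 - n%:R * expR (c - x * ln c))%:E <= P (max_degree_le x n))%E.
Proof.
move=> c1; rewrite max_degree_leE probability_setC; last first.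
  by apply: bigsetU_measurable => t _; exact: measurable_degree_gt.
rewrite EFinB; apply: leeB => //.
apply: (le_trans (Boole_inequality _ (A := fun t =>
  [set w | (x%:E < degree R (fun s => Z s w) t.+1%:Z)%E]) _)) => [t _|].
  exact: measurable_degree_gt.
apply: (@le_trans _ _ (\sum_(t < n) (expR (c - x * ln c))%:E)%E).
  by apply: lee_sum => t _; exact: prob_degree_gt.
by rewrite sumEFin sumr_const card_ord mulr_natl.
Qed.

End forest.

(** * Asymptotics of the union bound *)

Lemma cvg_ln_pinfty (R : realType) : (ln x : R) @[x --> +oo] --> +oo.
Proof.
apply/cvgryPge => A; near=> x.
have Ax : expR A <= x by near: x; exact: nbhs_pinfty_ge.
by rewrite -[A]expRK ler_ln ?posrE ?expR_gt0// (lt_le_trans _ Ax)// expR_gt0.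
Unshelve. all: by end_near. Qed.

Lemma cvg_ln_natr (R : realType) : (ln n%:R : R) @[n --> \oo] --> +oo.
Proof. exact: cvg_comp (@cvgr_idn R) (@cvg_ln_pinfty R). Qed.

Lemma cvg_lnln_natr (R : realType) : (ln (ln n%:R) : R) @[n --> \oo] --> +oo.
Proof. exact: cvg_comp (@cvg_ln_natr R) (@cvg_ln_pinfty R). Qed.

(** With L = ln n and l = ln L, the exponent of n * exp(...) equals
    - (eps / 2) L - (L / l) (eps / 4 * l + (1 + eps) ln (eps / 4)), and the last
    factor is nonnegative once l is large. *)
Lemma union_bound_cvg0 (R : realType) (eps : R) : 0 < eps ->
  n%:R * expR (eps / 4 * ln n%:R -
    (1 + eps) * (ln n%:R / ln (ln n%:R)) * ln (eps / 4 * ln n%:R))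
  @[n --> \oo] --> (0 : R).
Proof.
move=> e0.
have h0 : expR (- (eps / 2 * ln n%:R)) @[n --> \oo] --> (0 : R).
  have e20 : 0 < eps / 2 by lra.
  have h : expR (- (eps / 2 * y)) @[y --> +oo] --> (0 : R).
    exact: cvg_comp (gt0_cvgMry e20 cvg_id) (@cvgr_expR R).
  exact: cvg_comp (@cvg_ln_natr R) h.
apply: squeeze_cvgr (cvg_cst 0) h0.
near=> n.
have n0 : 0 < n%:R :> R by rewrite ltr0n; near: n; exact: nbhs_infty_gt.
have L0 : 0 < ln n%:R :> R.
  by near: n; exact: ((cvgryPgt _).1 (@cvg_ln_natr R)).
have l0 : 0 < ln (ln n%:R) :> R.
  by near: n; exact: ((cvgryPgt _).1 (@cvg_lnln_natr R)).
(* The threshold beyond which eps / 4 * l + (1 + eps) * ln (eps / 4) >= 0. *)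
have l1 : - (4 * (1 + eps) * ln (eps / 4) / eps) <= ln (ln n%:R).
  by near: n; exact: ((cvgryPge _).1 (@cvg_lnln_natr R)).
rewrite mulr_ge0 ?expR_ge0 ?ler0n//=.
rewrite -{1}(@lnK _ n%:R)// -expRD ler_expR.
rewrite lnM ?posrE//; last by lra.
set L := ln n%:R in L0 l0 l1 *.
set l := ln L in l0 l1 *; set a := ln (eps / 4) in l1 *.
have -> : L + (eps / 4 * L - (1 + eps) * (L / l) * (a + l)) =
    - (eps / 2 * L) - L / l * (eps / 4 * l + (1 + eps) * a).
  by field; rewrite gt_eqF.
rewrite gerBl mulr_ge0//; first by rewrite divr_ge0// ltW.
have -> : eps / 4 * l + (1 + eps) * a =
    eps / 4 * (l - - (4 * (1 + eps) * a / eps)).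
  by field; rewrite gt_eqF.
by rewrite mulr_ge0 ?subr_ge0//; lra.
Unshelve. all: by end_near. Qed.

Theorem proposition5 (R : realType) (d : measure_display)
    (T : measurableType d) (P : probability T R)
    (Z : nat -> {RV P >-> nat})
    (Zpos : forall (n : nat) (w : T), (0 < n)%N -> (0 < Z n w)%N)
    (Zindep : independent_RVs [set n : nat | (0 < n)%N] Z)
    (Zid : identically_distributed [set n : nat | (0 < n)%N] Z)
    (eps : R) (eps_gt0 : 0 < eps) :
  P [set w : T |
      (\big[maxe/-oo]_(1 <= t < n.+1) degree R (fun s => Z s w) t%:Z
        <= ((1 + eps) * (ln n%:R / ln (ln n%:R)))%:E)%E]
    @[n --> \oo] --> (1 : \bar R)%E.
Proof.
apply: (@squeeze_cvge _ _ _ _ (fun n => (1 - n%:R * expR (eps / 4 * ln n%:R -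
    (1 + eps) * (ln n%:R / ln (ln n%:R)) * ln (eps / 4 * ln n%:R)))%:E) _
    (fun=> 1%E)); last exact: cvg_cst.
  near=> n.
  apply/andP; split; last first.
    by apply: probability_le1; exact: measurable_max_degree_le.
  apply: prob_max_degree_le => //.
  rewrite mulrC -ler_pdivrMr; last lra.
  by near: n; exact: ((cvgryPge _).1 (@cvg_ln_natr R)).
apply: cvg_EFin; first exact: nearW.
rewrite -[X in _ --> X]subr0.
apply: cvgB; [exact: cvg_cst | exact: union_bound_cvg0].
Unshelve. all: by end_near. Qed.
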